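(* For $x,\theta>0$ let $d_{\rm IS}(x,\theta)=\frac{x}{\theta}-\log\frac{x}{\theta}-1$ be the Itakura–Saito distance. Let $g:[0,\infty)\to[0,\infty)$ be measurable such that $0<C:=\int_0^\infty \frac{1}{x}g(d_{\rm IS}(x,\theta))\,dx<\infty$ (this quantity does not depend on $\theta$), and consider the IS distribution $$p(x\mid\theta)=\frac{1}{C}\,\frac{1}{x}\,g\big(d_{\rm IS}(x,\theta)\big),\qquad x>0,\ \theta>0.$$ Let $f:[0,\infty)\to\mathbb{R}$ be differentiable. If $$\int_0^\infty g(t)\,|f'(t)|\,dt<\infty,$$ then for every $\theta>0$ $$\int_0^\infty p(x\mid\theta)\, f'\big(d_{\rm IS}(x,\theta)\big)\,(x-\theta)\,dx=0,$$ i.e. the estimating equation holds without any bias-correction term.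
   Context: The parameter is estimated by minimizing $\int p(x)\,f(d_{\rm IS}(x,\theta))\,dx$; since $d_{\rm IS}$ is the Bregman divergence generated by $\phi(x)=-\log x$, the stationarity condition is the displayed estimating equation, and ''unbiased'' means it is satisfied at the true parameter $\theta$ of the model. *)

(* Defs.v *)
From HB Require Import structures.
From mathcomp Require Import all_boot all_order all_algebra.
From mathcomp Require Import all_classical all_reals all_analysis.
Set Implicit Arguments. Unset Strict Implicit. Unset Printing Implicit Defensive.
Import Order.TTheory GRing.Theory Num.Theory.
Import numFieldNormedType.Exports.
Local Open Scope classical_set_scope.
Local Open Scope ring_scope.

Definition dIS {R : realType} (x theta : R) : R :=
  x / theta - ln (x / theta) - 1.

Definition ISconst {R : realType} (g : R -> R) (theta : R) : \bar R :=
  (\int[lebesgue_measure]_(x in `]0%R, +oo[%classic) (x^-1 * g (dIS x theta))%:E)%E.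

Definition ISdens {R : realType} (g : R -> R) (theta x : R) : R :=
  (fine (ISconst g theta))^-1 * x^-1 * g (dIS x theta).

(* Main.v *)
(* With h = g f' and phi = d_IS(., theta), the integrand is, up to the constant
   theta / C, equal to h(phi(x)) phi'(x), because phi'(x) = 1/theta - 1/x.
   The branches of phi on ]theta, +oo[ and on ]0, theta[ are both monotone
   bijections onto ]0, +oo[, so each contributes the integral of h over
   [0, +oo[, with opposite signs.  As h is merely measurable, the change of
   variables is obtained on measures: the push-forward of |phi'(x)| dx along a
   branch agrees with Lebesgue measure on the rays ]-oo, b[, by the fundamental
   theorem of calculus, hence on all Borel sets. *)
Require Import Defs.
From HB Require Import structures.
From mathcomp Require Import all_boot all_order all_algebra.
From mathcomp Require Import all_classical all_reals all_analysis.
From mathcomp Require Import measurable_realfun ring lra.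
Import Order.TTheory GRing.Theory Num.Theory.
Import numFieldNormedType.Exports.
Local Open Scope classical_set_scope.
Local Open Scope ring_scope.

(** * Change of variables along a map, with a density on the source *)

Definition weighted_pushforward {d1 d2} {X : measurableType d1}
    {Y : measurableType d2} {R : realType} (mu : {measure set X -> \bar R})
    (D : set X) (phi : X -> Y) (w : X -> R) (A : set Y) : \bar R :=
  (\int[mu]_(x in D `&` phi @^-1` A) (w x)%:E)%E.

Section weighted_transfer.
Local Set Implicit Arguments. Local Unset Strict Implicit.
Local Open Scope ereal_scope.
Context d1 d2 (X : measurableType d1) (Y : measurableType d2) (R : realType).
Variables (mu : {measure set X -> \bar R}) (nu : {measure set Y -> \bar R}).
Variables (D : set X) (E : set Y) (phi : X -> Y) (w : X -> R).
Hypotheses (mD : measurable D) (mE : measurable E).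
Hypotheses (mphi : measurable_fun D phi) (phiDE : forall x, D x -> E (phi x)).
Hypotheses (mw : measurable_fun D w) (w0 : forall x, D x -> (0 <= w x)%R).
Hypothesis nuE : forall A, measurable A ->
  nu (E `&` A) = weighted_pushforward mu D phi w A.

Import HBNNSimple.

(** On the indicator of one fibre of [h] this is the hypothesis [nuE]; both sides are then summed
    over the finite range of [h]. *)
Let transfer_nnsfun (h : {nnsfun Y >-> R}) :
  \int[nu]_(y in E) (h y)%:E = \int[mu]_(x in D) ((h (phi x))%:E * (w x)%:E).
Proof.
have mindic r : measurable_fun D (fun x => \1_(h @^-1` [set r]) (phi x) : R).
  by apply: measurableT_comp => //; exact: measurable_indic.
have mF (r : R) : measurable_fun D
    (fun x => (r * \1_(h @^-1` [set r]) (phi x))%:E * (w x)%:E).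
  apply: emeasurable_funM; last exact/measurable_EFinP.
  by apply/measurable_EFinP; apply: measurable_funM.
(* No sign condition on [r] is required: for [r < 0] the fibre of the nonnegative [h] is empty and
   the indicator vanishes. *)
have F0 (r : R) x : D x -> 0 <= (r * \1_(h @^-1` [set r]) (phi x))%:E * (w x)%:E.
  by move=> Dx; rewrite mule_ge0 ?nnfun_muleindic_ge0// lee_fin w0.
transitivity (\sum_(r \in range h) \int[mu]_(x in D)
    ((r * \1_(h @^-1` [set r]) (phi x))%:E * (w x)%:E)); last first.
  rewrite -ge0_integral_fsum//.
  apply: eq_integral => x _.
  rewrite -ge0_mule_fsuml => [|r]; last exact: nnfun_muleindic_ge0.
  by rewrite fsumEFin// -fimfunE.
under eq_integral do rewrite fimfunE -fsumEFin//.
rewrite ge0_integral_fsum//; last 2 first.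
- by move=> r; exact/measurable_EFinP/measurable_funM.
- by move=> r y _; rewrite nnfun_muleindic_ge0.
apply: eq_fsbigr => r rh.
have r0 : (0 <= r)%R by move: rh; rewrite inE => -[y _ <-].
rewrite integralZl_indic_nnsfun// integral_indic// setIC nuE//.
rewrite /weighted_pushforward integral_mkcondr.
under [RHS]eq_integral do rewrite EFinM -muleA.
rewrite ge0_integralZl_EFin//; last 2 first.
- by move=> x Dx; rewrite mule_ge0// lee_fin w0.
- by apply: emeasurable_funM; exact/measurable_EFinP.
congr (_ * _); apply: eq_integral => x _.
rewrite patchE indicE.
have -> : (x \in phi @^-1` (h @^-1` [set r])) = (phi x \in h @^-1` [set r]) 
  by apply/idP/idP => /set_mem ?; apply/mem_set.
by case: ifPn; rewrite ?mul1e ?mul0e.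
Qed.

(** Monotone convergence on both sides along simple approximations of [G]; multiplying by [w >= 0]
    keeps the sequence nondecreasing. *)
Lemma ge0_integral_weighted_transfer (G : Y -> \bar R) :
  measurable_fun E G -> (forall y, E y -> 0 <= G y) ->
  \int[nu]_(y in E) G y = \int[mu]_(x in D) (G (phi x) * (w x)%:E).
Proof.
move=> mG G0; pose h := nnsfun_approx mE mG.
transitivity (limn (fun n => \int[nu]_(y in E) (h n y)%:E)).
  rewrite -monotone_convergence//.
  - apply: eq_integral => y /[!inE] yE; apply/esym/cvg_lim => //.
    exact: cvg_nnsfun_approx.
  - by move=> n; exact/measurable_EFinP/measurable_funTS.
  - by move=> n y _; rewrite lee_fin.
  - by move=> y _ m n mn; rewrite lee_fin; exact/lefP/nd_nnsfun_approx.
under eq_fun do rewrite transfer_nnsfun.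
rewrite -monotone_convergence//.
- apply: eq_integral => x /[!inE] Dx; apply/cvg_lim => //.
  by apply: cvgeZr => //; apply: cvg_nnsfun_approx => //; exact: phiDE.
- move=> n; apply: emeasurable_funM; last exact/measurable_EFinP.
  by apply/measurable_EFinP; exact: measurableT_comp.
- by move=> n x Dx; rewrite mule_ge0// lee_fin ?w0.
- move=> x Dx m n mn; rewrite lee_wpmul2r ?lee_fin ?w0//.
  exact/lefP/nd_nnsfun_approx.
Qed.

Lemma measurable_weighted_transfer (G : Y -> \bar R) : measurable_fun E G ->
  measurable_fun D (fun x => G (phi x) * (w x)%:E).
Proof.
move=> mG; apply: emeasurable_funM; last exact/measurable_EFinP.
apply: (measurable_comp mE) => //.
by move=> _ [x Dx <-]; exact: phiDE.
Qed.

(** The nonnegative case applied to [|G|], since the weight comes out of the absolute value. *)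
Lemma integrable_weighted_transfer (G : Y -> \bar R) : nu.-integrable E G ->
  mu.-integrable D (fun x => G (phi x) * (w x)%:E).
Proof.
move=> /integrableP[mG Goo]; apply/integrableP; split.
  exact: measurable_weighted_transfer.
rewrite (_ : (\int[mu]_(x in D) _) = \int[nu]_(y in E) `|G y|)//.
rewrite ge0_integral_weighted_transfer//; last exact: measurableT_comp.
apply: eq_integral => x /[!inE] Dx.
by rewrite abseM/= ger0_norm// w0.
Qed.

Lemma integral_weighted_transfer (G : Y -> \bar R) : nu.-integrable E G ->
  \int[nu]_(y in E) G y = \int[mu]_(x in D) (G (phi x) * (w x)%:E).
Proof.
move=> iG.
rewrite integralE ge0_integral_weighted_transfer//; last first.
  exact/measurable_funepos/(measurable_int nu).
rewrite ge0_integral_weighted_transfer//; last first.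
  exact/measurable_funeneg/(measurable_int nu).
rewrite -integralB//; last 2 first.
- by apply: integrable_weighted_transfer; exact: integrable_funepos.
- by apply: integrable_weighted_transfer; exact: integrable_funeneg.
apply: eq_integral => x _ /=.
(* Distributing the weight is legitimate because the positive and negative parts are never infinite
   together. *)
by rewrite [in RHS](funeposneg G) muleBl//; exact: add_def_funeposneg.
Qed.

End weighted_transfer.

(** * Identification of a weighted push-forward from its values on rays *)

Section weighted_pushforward_ray.
Local Set Implicit Arguments. Local Unset Strict Implicit.
Local Open Scope ereal_scope.
Context d1 (X : measurableType d1) (R : realType).
Variables (mu : {measure set X -> \bar R}).
Variables (D : set X) (phi : X -> measurableTypeR R) (w : X -> R).
Hypotheses (mD : measurable D) (mphi : measurable_fun D phi).
Hypotheses (mw : measurable_fun D w) (w0 : forall x, D x -> (0 <= w x)%R).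

Let nuw := weighted_pushforward mu D phi w.

Let nuw0 : nuw set0 = 0.
Proof. by rewrite /nuw /weighted_pushforward preimage_set0 setI0 integral_set0. Qed.

Let nuw_ge0 A : 0 <= nuw A.
Proof. by apply: integral_ge0 => x [Dx _]; rewrite lee_fin w0. Qed.

(** Preimages of disjoint sets are disjoint, and the integral of a nonnegative function is countably
    additive in its domain. This makes [nuw] a measure, to which the uniqueness theorem applies. *)
Let nuw_sigma_additive : semi_sigma_additive nuw.
Proof.
move=> /= F mF tF mUF; rewrite /nuw /weighted_pushforward; apply: cvg_toP.
  apply: ereal_nondecreasing_is_cvgn => m n mn.
  by apply: lee_sum_nneg_natr => // k _ _; exact: nuw_ge0.
rewrite preimage_bigcup setI_bigcupr ge0_integral_bigcup//=.
- by move=> k; exact: mphi.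
- rewrite -setI_bigcupr; apply/measurable_EFinP.
  by apply: (measurable_funS mD) => // x [].
- by move=> x [k _ [Dx _]]; rewrite lee_fin w0.
- apply/trivIsetP => i j _ _ ij.
  move/trivIsetP : tF => /(_ i j Logic.I Logic.I ij) Fij.
  by rewrite setIACA setIid -preimage_setI Fij preimage_set0 setI0.
Qed.

HB.instance Definition _ :=
  isMeasure.Build _ _ _ nuw nuw0 nuw_ge0 nuw_sigma_additive.

Variables (nu : {measure set (measurableTypeR R) -> \bar R})
  (E : set (measurableTypeR R)).
Hypothesis mE : measurable E.
Hypothesis nuE_ray : forall b : R, nu (E `&` `]-oo, b[) = nuw `]-oo, b[.
Hypothesis nuE_fin : forall b : R, nu (E `&` `]-oo, b[) < +oo.

(* The rays ]-oo, b[ form a pi-system generating the Borel sets. *)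
Lemma weighted_pushforward_ray_unique A : measurable A ->
  nu (E `&` A) = weighted_pushforward mu D phi w A.
Proof.
(* The left side is read as the restriction of [nu] to [E], so that two measures are compared; the
   rays []-oo, n[] exhaust the line with finite measure. *)
move=> mA; rewrite setIC -/(mrestr nu mE A) -/(nuw A).
apply: (measure_unique (T := measurableTypeR R) (@RGenInftyO.G R)
  (fun n => `]-oo, n%:R[%classic) _ _ _ _ (mrestr nu mE) nuw) => //.
- exact: RGenInftyO.measurableE.
- move=> _ _ [x ->] [y ->]; exists (Num.min x y).
  by apply/seteqP; split => z /=; rewrite !in_itv/= lt_min; [case=> -> ->|case/andP].
- by move=> n; exists n%:R.
- apply/seteqP; split => // x _; exists (Num.truncn `|x|).+1 => //=.
  by rewrite in_itv/= (le_lt_trans (ler_norm x))// truncnS_gt.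
- by move=> _ [b ->] /=; rewrite /mrestr setIC nuE_ray.
- by move=> n /=; rewrite /mrestr setIC.
Qed.

End weighted_pushforward_ray.

(** * Convexity, monotonicity and calculus of the Itakura-Saito distance *)

Section dIS_theory.
Local Set Implicit Arguments. Local Unset Strict Implicit.
Context {R : realType} (theta : R).
Hypothesis theta0 : 0 < theta.
Implicit Types x y b : R.

Lemma dISxx : dIS theta theta = 0.
Proof. by rewrite /dIS divff ?gt_eqF// ln1 subr0 subrr. Qed.

Lemma is_derive_dIS x : 0 < x ->
  is_derive x 1 (dIS ^~ theta) (theta^-1 - x^-1).
Proof.
move=> x0.
have xt0 : 0 < x / theta by rewrite divr_gt0.
have dxt : is_derive x 1 (fun z => z / theta) theta^-1.
  have -> : (fun z => z / theta) = theta^-1 \*: (id : R -> R).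
    by apply/funext => z; rewrite /GRing.scale/= mulrC.
  by apply: is_derive_eq; rewrite /GRing.scale/= mulr1.
have dln : is_derive x 1 (@ln R \o (fun z => z / theta)) x^-1.
  have := is_derive1_ln xt0 => dl.
  apply: is_derive_eq.
  by rewrite /GRing.scale/= invf_div mulrC mulrA mulVf ?mul1r// gt_eqF.
rewrite (_ : dIS ^~ theta = (fun z => z / theta) - (@ln R \o (fun z => z / theta)) - cst 1)//.
by apply: is_derive_eq; rewrite subr0.
Qed.

Lemma continuous_dIS x : 0 < x -> {for x, continuous (dIS ^~ theta : R -> R)}.
Proof.
move=> x0; apply: differentiable_continuous.
by apply/derivable1_diffP; have [] := is_derive_dIS x0.
Qed.

Lemma measurable_dIS (D : set R) : measurable_fun D (dIS ^~ theta).
Proof.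
apply: measurable_funTS; apply: measurable_funB => //.
by apply: measurable_funB; [|apply: measurableT_comp => //];
  exact: measurable_funM.
Qed.

(* Strict convexity: the graph lies above its tangent lines. *)
Lemma dIS_tangent x y : 0 < x -> 0 < y -> x != y ->
  (y - x) * (theta^-1 - x^-1) < dIS y theta - dIS x theta.
Proof.
move=> x0 y0 xy.
have yx0 : 0 < y / x by rewrite divr_gt0.
have lnyx0 : ln (y / x) != 0 by rewrite ln_eq0//; apply: contra xy => /eqP/divr1_eq ->.
(* The strict inequality [1 + u < expR u] at [u = ln (y / x)]; the gap between graph and tangent is
   exactly [y / x - 1 - ln (y / x)]. *)
have := expR_gt1Dx lnyx0; rewrite lnK ?posrE//.
rewrite /dIS !ln_div ?posrE// => h.
have -> : (y - x) * (theta^-1 - x^-1) = y / theta - x / theta - (y / x - 1).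
  by field; rewrite !gt_eqF.
lra.
Qed.

(** The tangent at [theta] is the horizontal axis. *)
Lemma dIS_ge0 x : 0 < x -> 0 <= dIS x theta.
Proof.
move=> x0; have [<-|xt] := eqVneq theta x; first by rewrite dISxx.
have := dIS_tangent theta0 x0 xt.
by rewrite subrr mulr0 dISxx subr0 => /ltW.
Qed.

(** To the right of [theta] the tangent at [x] has nonnegative slope, and the graph at [y] lies
    strictly above it. *)
Lemma lt_dIS_right x y : theta <= x -> x < y -> dIS x theta < dIS y theta.
Proof.
move=> tx xy; have x0 := lt_le_trans theta0 tx.
rewrite -subr_gt0; apply: le_lt_trans (dIS_tangent x0 (lt_trans x0 xy) _).
  by rewrite mulr_ge0 ?subr_ge0 ?(ltW xy)// lef_pV2 ?posrE.
by rewrite lt_eqF.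
Qed.

Lemma lt_dIS_left x y : 0 < y -> x <= theta -> y < x ->
  dIS x theta < dIS y theta.
Proof.
move=> y0 xt yx; have x0 := lt_trans y0 yx.
rewrite -subr_gt0; apply: le_lt_trans (dIS_tangent x0 y0 _).
  by rewrite mulr_le0 ?subr_le0 ?(ltW yx)// lef_pV2 ?posrE.
by rewrite gt_eqF.
Qed.

Lemma dIS_surj_right b : 0 < b -> exists2 y, theta < y & dIS y theta = b.
Proof.
(* The tangent at [2 * theta] has slope [1 / (2 * theta)] and rises by exactly [b] between
   [2 * theta] and [z]; as it starts at a nonnegative height, [dIS z theta >= b]. *)
move=> b0; pose z := 2 * theta * (b + 1); have t0 := theta0.
have tb0 := mulr_gt0 theta0 b0.
have tz : theta < z by rewrite /z; lra.
have bz : b <= dIS z theta.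
  have t20 : 0 < 2 * theta by rewrite mulr_gt0.
  have z0 := lt_trans theta0 tz.
  have tz2 : 2 * theta != z by rewrite /z; apply/eqP; lra.
  have := dIS_tangent t20 z0 tz2; have := dIS_ge0 t20.
  rewrite (_ : (z - 2 * theta) * (theta^-1 - (2 * theta)^-1) = b); first lra.
  by rewrite /z; field; rewrite gt_eqF.
have [||y] := @IVT R (dIS ^~ theta) theta z b (ltW tz).
- apply: continuous_in_subspaceT => x /[!inE]/=; rewrite in_itv/= => /andP[tx _].
  exact/continuous_dIS/(lt_le_trans theta0 tx).
- by rewrite dISxx ge_min le_max (ltW b0) bz orbT.
(* The intermediate value theorem gives a closed interval; the endpoint [theta] is excluded because
   it would force [b = 0]. *)
rewrite in_itv/= => /andP[]; rewrite le_eqVlt => /predU1P[<- _|ty _ yb].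
  by rewrite dISxx => b00; rewrite b00 ltxx in b0.
by exists y.
Qed.

Lemma dIS_surj_left b : 0 < b -> exists2 y, 0 < y < theta & dIS y theta = b.
Proof.
(* With this [z], [dIS z theta] equals [expR (- (b + 1)) + b], which exceeds [b]. *)
move=> b0; pose z := theta * expR (- (b + 1)).
have z0 : 0 < z by rewrite mulr_gt0 ?expR_gt0.
have zt : z < theta.
  by rewrite /z -[ltRHS]mulr1 ltr_pM2l// expR_lt1 oppr_lt0 addr_gt0.
have bz : b <= dIS z theta.
  rewrite /dIS /z mulrAC divff ?gt_eqF// mul1r expRK.
  by have := expR_gt0 (- (b + 1)); lra.
have [||y] := @IVT R (dIS ^~ theta) z theta b (ltW zt).
- apply: continuous_in_subspaceT => x /[!inE]/=; rewrite in_itv/= => /andP[zx _].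
  exact/continuous_dIS/(lt_le_trans z0 zx).
- by rewrite dISxx ge_min le_max (ltW b0) bz orbT.
rewrite in_itv/= => /andP[zy]; rewrite le_eqVlt => /predU1P[->|yt yb].
  by rewrite dISxx => b00; rewrite b00 ltxx in b0.
by exists y => //; rewrite yt (lt_le_trans z0 zy).
Qed.

Let continuous_itv (u v : R) (F : R -> R) : 0 < u ->
  (forall x, 0 < x -> {for x, continuous F}) -> {within `[u, v], continuous F}.
Proof.
move=> u0 cF; apply: continuous_in_subspaceT => x /[!inE]/=.
by rewrite in_itv/= => /andP[ux _]; exact/cF/(lt_le_trans u0 ux).
Qed.

(** The factor [s] is a sign: [1] serves the increasing branch and [-1] the decreasing one. *)
Lemma integral_derive_dIS (s u v : R) : 0 < u -> u < v ->
  (\int[lebesgue_measure]_(x in `[u, v]) (s * (theta^-1 - x^-1))%:E =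
   (s * (dIS v theta - dIS u theta))%:E)%E.
Proof.
move=> u0 uv.
have dF x : 0 < x ->
    is_derive x 1 (s \*: (dIS ^~ theta)) (s * (theta^-1 - x^-1)).
  by move=> x0; have := is_derive_dIS x0 => ?; apply: is_derive_eq.
have cF x : 0 < x -> {for x, continuous (s \*: (dIS ^~ theta : R -> R))}.
  move=> x0; apply: differentiable_continuous.
  by apply/derivable1_diffP; have [] := dF _ x0.
rewrite mulrBr EFinB.
apply: (@continuous_FTC2 R _ (s \*: (dIS ^~ theta))) => //.
- apply: continuous_itv => // x x0.
  apply: cvgM; first exact: cvg_cst.
  apply: cvgB; first exact: cvg_cst.
  by apply: cvgV; [rewrite gt_eqF|exact: cvg_id].
- split.
  + move=> x /[!in_itv]/= /andP[ux _].
    by have [] := dF x (lt_trans u0 ux).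
  + exact/cvg_at_right_filter/cF.
  + exact/cvg_at_left_filter/cF/(lt_trans u0 uv).
- move=> x /[!in_itv]/= /andP[ux _].
  by rewrite derive1E; have [_] := dF x (lt_trans u0 ux).
Qed.

End dIS_theory.

(** * Push-forward of the weighted Lebesgue measure along each branch *)

Section dIS_branches.
Local Set Implicit Arguments. Local Unset Strict Implicit.
Context {R : realType} (theta : R).
Hypothesis theta0 : 0 < theta.

(** Both weights are the absolute derivative of [dIS] on one branch, extended by zero, so that the
    two branches are integrated over the same domain and can be subtracted pointwise. *)
Definition dIS_weight_right : R -> R :=
  (fun x => theta^-1 - x^-1) \_ `]theta, +oo[%classic.

Definition dIS_weight_left : R -> R :=
  (fun x => x^-1 - theta^-1) \_ `]0%R, theta[%classic.

Let measurable_derive_dIS (A : set R) : measurable A ->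
  A `<=` `]0%R, +oo[%classic -> measurable_fun A (fun x => theta^-1 - x^-1).
Proof.
move=> mA A0; apply: measurable_funB => //.
apply: (measurable_funS _ A0) => //.
apply: open_continuous_measurable_fun => //.
move=> x; rewrite inE/= in_itv/= andbT => x0.
by apply: cvgV; [rewrite gt_eqF|exact: cvg_id].
Qed.

Let measurable_oppr_derive_dIS (A : set R) : measurable A ->
  A `<=` `]0%R, +oo[%classic -> measurable_fun A (fun x => x^-1 - theta^-1).
Proof.
move=> mA A0; under eq_fun do rewrite -opprB.
by apply: measurableT_comp => //; exact: measurable_derive_dIS.
Qed.

Let subset_gt0 (y : R) b : 0 <= y ->
  [set` Interval (BRight y) b] `<=` `]0%R, +oo[%classic.
Proof.
by move=> y0 x /=; rewrite !in_itv/= andbT => /andP[yx _]; exact: le_lt_trans yx.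
Qed.

Lemma measurable_dIS_weight_right D : measurable D ->
  measurable_fun D dIS_weight_right.
Proof.
move=> mD; apply: (measurable_funS measurableT) => //.
have mf := measurable_derive_dIS (measurable_itv `]theta, +oo[) (subset_gt0 (ltW theta0)).
exact: (measurable_restrictT _ (measurable_itv _)).1 mf.
Qed.

Lemma measurable_dIS_weight_left D : measurable D ->
  measurable_fun D dIS_weight_left.
Proof.
move=> mD; apply: (measurable_funS measurableT) => //.
have mf := measurable_oppr_derive_dIS (measurable_itv `]0, theta[) (subset_gt0 (lexx 0)).
exact: (measurable_restrictT _ (measurable_itv _)).1 mf.
Qed.

Lemma dIS_weight_right_ge0 x : 0 <= dIS_weight_right x.
Proof.
rewrite /dIS_weight_right patchE; case: ifPn => // /[!inE]/=.
rewrite in_itv/= andbT => tx.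
by rewrite subr_ge0 lef_pV2 ?posrE ?ltW// (lt_trans theta0).
Qed.

Lemma dIS_weight_left_ge0 x : 0 <= dIS_weight_left x.
Proof.
rewrite /dIS_weight_left patchE; case: ifPn => // /[!inE]/=.
rewrite in_itv/= => /andP[x0 xt].
by rewrite subr_ge0 lef_pV2 ?posrE ?ltW.
Qed.

(** The opposite signs of the branches recombine into the signed derivative; at [x = theta] both
    weights and the derivative vanish. *)
Lemma dIS_weightB x : 0 < x ->
  dIS_weight_right x - dIS_weight_left x = theta^-1 - x^-1.
Proof.
move=> x0; rewrite /dIS_weight_right /dIS_weight_left !patchE.
rewrite !mem_setE !in_itv/= x0 andbT.
by case: ltgtP => [| |->]; rewrite ?subr0 ?sub0r ?opprB ?subrr.
Qed.

Let lebesgue_ray (b : R) :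
  lebesgue_measure (`[0, +oo[%classic `&` `]-oo, b[%classic) =
  (Num.max 0 b)%:E.
Proof.
rewrite (_ : _ `&` _ = `[0, b[%classic).
  by rewrite lebesgue_measure_itv/= lte_fin; case: ltP; rewrite ?oppr0 ?adde0.
by apply/seteqP; split => x /=; rewrite !in_itv/= ?andbT; [case=> -> ->|case/andP].
Qed.

Let weight_ray_le0 (w : R -> R) (b : R) : b <= 0 ->
  weighted_pushforward lebesgue_measure `]0%R, +oo[%classic
    (dIS ^~ theta : R -> measurableTypeR R) w `]-oo, b[%classic = 0%E.
Proof.
move=> b0; rewrite /weighted_pushforward (_ : _ `&` _ = set0) ?integral_set0//.
rewrite -subset0 => x [] /=; rewrite !in_itv/= andbT => x0.
by apply/negP; rewrite -leNgt (le_trans b0)// dIS_ge0.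
Qed.

(** For [b > 0], the part of the branch where [dIS] is below [b] is []theta, y[] with
    [dIS y theta = b], and the weight integrates there to [b - 0], the length of [[0, b[]. *)
Lemma weighted_pushforward_right (A : set (measurableTypeR R)) : measurable A ->
  lebesgue_measure (`[0%R, +oo[%classic `&` A) =
  weighted_pushforward lebesgue_measure `]0%R, +oo[%classic
    (dIS ^~ theta) dIS_weight_right A.
Proof.
apply: weighted_pushforward_ray_unique => //.
- exact: measurable_dIS.
- exact: measurable_dIS_weight_right.
- by move=> x _; exact: dIS_weight_right_ge0.
- move=> b; rewrite [LHS]lebesgue_ray; have [b0|b0] := leP b 0.
    by rewrite [RHS]weight_ray_le0.
  have [y ty yb] := dIS_surj_right theta0 b0.
  rewrite /weighted_pushforward -[X in integral _ _ X]/(EFin \o dIS_weight_right).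
  rewrite /dIS_weight_right -restrict_EFin -integral_mkcondr.
  rewrite (_ : _ `&` _ = `]theta, y[%classic); last first.
    apply/seteqP; split => x /=; rewrite !in_itv/= !andbT.
      move=> [[x0 xb] tx]; rewrite tx/= ltNge; apply/negP.
      rewrite le_eqVlt => /predU1P[yx|yx].
        by rewrite -yx yb ltxx in xb.
      by have := lt_dIS_right theta0 (ltW ty) yx; rewrite yb ltNge (ltW xb).
    move=> /andP[tx xy]; rewrite tx (lt_trans theta0 tx); do 2 split => //.
    by rewrite -yb; exact: lt_dIS_right (ltW tx) xy.
  (* Adding the two endpoints, a null set, gives the closed interval on which the fundamental
     theorem was stated. *)
  rewrite -(@integral_itv_bndoo _ _ _ _ true false); last first.
    apply/measurable_EFinP; exact: (measurable_derive_dIS (measurable_itv _) (subset_gt0 (ltW theta0))).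
  have := integral_derive_dIS theta0 1 theta0 ty.
  rewrite mul1r dISxx// subr0 yb => <-.
  by apply: eq_integral => x _; rewrite mul1r.
- by move=> b; rewrite [ltLHS]lebesgue_ray ltry.
Qed.

(** Here [dIS] decreases, so the relevant set is []y, theta[], and the sign [-1] turns [0 - b] into
    [b]. *)
Lemma weighted_pushforward_left (A : set (measurableTypeR R)) : measurable A ->
  lebesgue_measure (`[0%R, +oo[%classic `&` A) =
  weighted_pushforward lebesgue_measure `]0%R, +oo[%classic
    (dIS ^~ theta) dIS_weight_left A.
Proof.
apply: weighted_pushforward_ray_unique => //.
- exact: measurable_dIS.
- exact: measurable_dIS_weight_left.
- by move=> x _; exact: dIS_weight_left_ge0.
- move=> b; rewrite [LHS]lebesgue_ray; have [b0|b0] := leP b 0.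
    by rewrite [RHS]weight_ray_le0.
  have [y /andP[y0 yt] yb] := dIS_surj_left theta0 b0.
  rewrite /weighted_pushforward -[X in integral _ _ X]/(EFin \o dIS_weight_left).
  rewrite /dIS_weight_left -restrict_EFin -integral_mkcondr.
  rewrite (_ : _ `&` _ = `]y, theta[%classic); last first.
    apply/seteqP; split => x /=; rewrite !in_itv/= !andbT.
      move=> [[x0 xb] /andP[_ xt]]; rewrite xt andbT ltNge; apply/negP.
      rewrite le_eqVlt => /predU1P[yx|yx].
        by rewrite yx yb ltxx in xb.
      by have := lt_dIS_left theta0 x0 (ltW yt) yx; rewrite yb ltNge (ltW xb).
    move=> /andP[yx xt]; rewrite xt (lt_trans y0 yx); do 2 split => //.
    by rewrite -yb; exact: lt_dIS_left y0 (ltW xt) yx.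
  rewrite -(@integral_itv_bndoo _ _ _ _ true false); last first.
    apply/measurable_EFinP; exact: (measurable_oppr_derive_dIS (measurable_itv _) (subset_gt0 (ltW y0))).
  have := integral_derive_dIS theta0 (-1) y0 yt.
  rewrite mulN1r dISxx// sub0r opprK yb => <-.
  by apply: eq_integral => x _; rewrite mulN1r opprB.
- by move=> b; rewrite [ltLHS]lebesgue_ray ltry.
Qed.

End dIS_branches.

(** * Cancellation of the two branches in the estimating equation *)

Theorem mainTheorem2 (R : realType) (g f : R -> R) :
  measurable_fun ((`[0%R, +oo[%classic : set R) : set R) g ->
  (forall t : R, 0 <= t -> 0 <= g t) ->
  (forall t : R, 0 <= t -> derivable f t 1) ->
  lebesgue_measure.-integrable ((`[0%R, +oo[%classic : set R) : set R)
    (fun t : R => (g t * derive1 f t)%:E) ->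
  forall theta : R, 0 < theta ->
  (0 < ISconst g theta < +oo)%E ->
  lebesgue_measure.-integrable (`]0%R, +oo[%classic : set R)
    (fun x : R => (ISdens g theta x * derive1 f (dIS x theta) * (x - theta))%:E) /\
  (\int[lebesgue_measure]_(x in (`]0%R, +oo[%classic : set R))
     (ISdens g theta x * derive1 f (dIS x theta) * (x - theta))%:E = 0)%E.
Proof.
move=> _ _ _ ih theta theta0 _.
pose h t := (g t * derive1 f t)%:E.
(* From [x - theta = theta * x * (theta^-1 - x^-1)]: the factor [x] cancels the [x^-1] of the
   density, and [theta] joins the normalizing constant. *)
pose k := (fine (ISconst g theta))^-1 * theta.
pose D : set (measurableTypeR R) := `]0%R, +oo[%classic.
have mD : measurable D by exact: measurable_itv.
have mE : measurable (`[0%R, +oo[%classic : set (measurableTypeR R)) by exact: measurable_itv.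
have phiDE x : D x -> (`[0%R, +oo[%classic : set R) (dIS x theta).
  by rewrite /D /= !in_itv/= !andbT; exact: dIS_ge0.
have mR := measurable_dIS_weight_right theta0 mD.
have mL := measurable_dIS_weight_left theta mD.
have mphi := @measurable_dIS R theta D.
have wR0 x : D x -> 0 <= dIS_weight_right theta x.
  by move=> _; exact: dIS_weight_right_ge0.
have wL0 x : D x -> 0 <= dIS_weight_left theta x.
  by move=> _; exact: dIS_weight_left_ge0.
pose mu : {measure set (measurableTypeR R) -> \bar R} := lebesgue_measure.
have pR (A : set (measurableTypeR R)) : measurable A -> mu (`[0%R, +oo[%classic `&` A) =
    weighted_pushforward mu D (dIS ^~ theta) (dIS_weight_right theta) A.
  exact: weighted_pushforward_right.
have pL (A : set (measurableTypeR R)) : measurable A -> mu (`[0%R, +oo[%classic `&` A) =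
    weighted_pushforward mu D (dIS ^~ theta) (dIS_weight_left theta) A.
  exact: weighted_pushforward_left.
(* Integrability is obtained on each branch separately, which allows the integral of the difference
   to be split. *)
have iR := integrable_weighted_transfer (mu := mu) (nu := mu) mD mE mphi phiDE mR wR0 pR ih.
have iL := integrable_weighted_transfer (mu := mu) (nu := mu) mD mE mphi phiDE mL wL0 pL ih.
have hE x : x \in D ->
  (k%:E * (h (dIS x theta) * (dIS_weight_right theta x)%:E -
           h (dIS x theta) * (dIS_weight_left theta x)%:E))%E =
  (ISdens g theta x * derive1 f (dIS x theta) * (x - theta))%:E.
  rewrite inE /D /= in_itv/= andbT => x0.
  transitivity (k * (g (dIS x theta) * derive1 f (dIS x theta) *
      (dIS_weight_right theta x - dIS_weight_left theta x)))%:E.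
    by rewrite mulrBr.
  rewrite dIS_weightB//; congr EFin.
  rewrite /ISdens /k; set c := (fine _)^-1; set u := dIS x theta.
  by field; rewrite !gt_eqF.
have iRL := integrableB mD iR iL.
split; first by apply: (eq_integrable mD _ _ hE); exact: integrableZl.
rewrite -(eq_integral _ _ hE) integralZl// integralB//.
rewrite -(integral_weighted_transfer (mu := mu) (nu := mu) mD mE mphi phiDE mR wR0 pR ih).
rewrite -(integral_weighted_transfer (mu := mu) (nu := mu) mD mE mphi phiDE mL wL0 pL ih).
(* Both branches give the integral of [h]; it is finite by [ih], so the extended-real difference is
   really zero. *)
by rewrite subee ?mule0//; exact: integrable_fin_num.
Qed.
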